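(* $$\frac{416\sqrt2}{81}=\sum_{j=0}^{\infty}\left(-\frac14\right)^{j}\frac{\left(\frac78\right)_j\left(\frac54\right)_j\left(\frac{11}{8}\right)_j}{(1)_j\left(\frac{17}{12}\right)_j\left(\frac{25}{12}\right)_j}\,(8j+9).$$
   Context: $(x)_0=1$ and $(x)_j=x(x+1)\cdots(x+j-1)$ for positive integers $j$ (rising factorial). *)

(* Defs.v *)
From Stdlib Require Import Reals.
From Coquelicot Require Import Coquelicot.
Open Scope R_scope.

(* (x)_j = x (x + 1) ... (x + j - 1), with (x)_0 = 1. *)
Fixpoint rising (x : R) (j : nat) : R :=
  match j with
  | O => 1
  | S k => rising x k * (x + INR k)
  end.

(* Main.v *)
Require Import Defs.
From Stdlib Require Import Reals Lra Lia.
From Coquelicot Require Import Coquelicot.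
Open Scope R_scope.

(** The series is one member of a family with three free parameters.  For
    [0 < u, w < 1] and [p > 0] put
    [[
      T(p,j) = (-1)^j (p)_{2j+1} (1-u)_j (1-w)_j (p+u+w)_j
               / (j! (p+u)_{2j+2} (p+w)_{2j+2}) * P(p,j)
    ]]
    with [P] the polynomial [cubic], of degree 3 in [j].  At [p = 3/4],
    [u = 5/12], [w = 1/12] the polynomial factors as
    [10 (j + 9/8) (j + 7/12) (j + 11/12)]; the last two factors cancel against
    the rising factorials and what remains is the given summand, up to the
    constant [208/27] ([summand_eq]).

    The parameter [p] is moved by creative telescoping: with
    [rho(p) = (p+u)(p+w) / (p (p+u+w))] there is an explicit [G] such that
    [T(p+1,j) - rho(p) T(p,j) = rho(p) (G(p,j+1) - G(p,j))] and [G(p,0) = 0]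
    ([term_telescopes]).  So the sum [S(p)] of the series satisfies
    [S(p+1) = rho(p) S(p)].  When [p] tends to infinity [T(p,0)] tends to 1 and
    every other term to 0, whence [S(p)] is the infinite product of the numbers
    [1 / rho(p+n)] ([series_of_product]).  The pair [(T,G)] comes from Gauss's
    summation theorem for 2F1 at argument 1: it is the companion of that
    theorem when [j] shifts the parameters of the 2F1.

    For the given parameters the product is
    [[
      prod_{k>=1} (1 - 1/(16 k^2)) / (1 - 1/(36 k^2)) = 2 sqrt 2 / 3,
    ]]
    a quotient of two values of Euler's sine product.  It is computed in
    [invprod_lim] by Wallis's method, from the integrals of
    [cos^n t * cos (y t)] from 0 to [pi/2]. *)

(** * Rising factorials *)

Lemma rising_pos (x : R) (j : nat) : 0 < x -> 0 < rising x j.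
Proof.
  intros Hx; induction j as [|j IH]; simpl; [lra|].
  apply Rmult_lt_0_compat; [exact IH|]. pose proof (pos_INR j); lra.
Qed.

Lemma rising_shift (x : R) (j : nat) :
  x * rising (x + 1) j = rising x j * (x + INR j).
Proof.
  induction j as [|j IH]; [simpl; ring|].
  change (rising (x + 1) (S j)) with (rising (x + 1) j * (x + 1 + INR j)).
  change (rising x (S j)) with (rising x j * (x + INR j)).
  rewrite S_INR, <- IH; ring.
Qed.

Lemma rising_SS (x : R) (j : nat) :
  rising x (S (S j)) = rising x j * (x + INR j) * (x + INR j + 1).
Proof.
  change (rising x (S (S j))) with (rising x j * (x + INR j) * (x + INR (S j))).
  rewrite S_INR; ring.
Qed.

(** * The three-parameter family and its telescoping *)

Definition weight (u w p : R) (j : nat) : R :=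
  (-1) ^ j
  * (rising p (2 * j + 1) * rising (1 - u) j * rising (1 - w) j
     * rising (p + u + w) j)
  / (rising 1 j * rising (p + u) (2 * j + 2) * rising (p + w) (2 * j + 2)).

(** The polynomial that Gosper's algorithm produces when it is applied to the
    difference in [j] of the normalised summand of Gauss's theorem.  For
    [u, w, p > 0] all its coefficients are positive. *)
Definition cubic (u w p x : R) : R :=
  10 * x ^ 3 + (15 * p + 8 * (u + w) + 11) * x ^ 2
  + (7 * p ^ 2 + 6 * p * (u + w) + 12 * p + u * w + 8 * (u + w) + 3) * x
  + (p + 1) * (p + 2) * (p + u + w).

Definition term (u w p : R) (j : nat) : R :=
  weight u w p j * cubic u w p (INR j).

(** The telescoping certificate [G].  The factor [INR j] makes it vanish at
    [j = 0], so that telescoped sums have no boundary contribution there. *)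
Definition cert (u w p : R) (j : nat) : R :=
  INR j * (p + u + 2 * INR j + 1) * (p + w + 2 * INR j + 1) * weight u w p j.

Definition rho (u w p : R) : R := (p + u) * (p + w) / (p * (p + u + w)).

Lemma weight_S (u w p : R) (j : nat) :
  0 < u < 1 -> 0 < w < 1 -> 0 < p ->
  weight u w p (S j) =
  - weight u w p j
  * ((p + 2 * INR j + 1) * (p + 2 * INR j + 2) * (1 - u + INR j)
     * (1 - w + INR j) * (p + u + w + INR j))
  / ((INR j + 1) * (p + u + 2 * INR j + 2) * (p + u + 2 * INR j + 3)
     * (p + w + 2 * INR j + 2) * (p + w + 2 * INR j + 3)).
Proof.
  intros Hu Hw Hp; unfold weight.
  replace (2 * S j + 1)%nat with (S (S (2 * j + 1))) by lia.
  replace (2 * S j + 2)%nat with (S (S (2 * j + 2))) by lia.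
  rewrite !rising_SS.
  change (rising ?x (S j)) with (rising x j * (x + INR j)).
  rewrite !plus_INR, !mult_INR.
  pose proof (pos_INR j) as Hj.
  pose proof (rising_pos 1 j Rlt_0_1).
  pose proof (rising_pos (p + u) (2 * j + 2) ltac:(lra)).
  pose proof (rising_pos (p + w) (2 * j + 2) ltac:(lra)).
  set (x := INR j) in *. simpl INR. simpl pow.
  field. repeat split; lra.
Qed.

Lemma weight_shift (u w p : R) (j : nat) :
  0 < u < 1 -> 0 < w < 1 -> 0 < p ->
  weight u w (p + 1) j =
  rho u w p * weight u w p j
  * ((p + 2 * INR j + 1) * (p + u + w + INR j))
  / ((p + u + 2 * INR j + 2) * (p + w + 2 * INR j + 2)).
Proof.
  intros Hu Hw Hp; unfold weight, rho.
  assert (E : forall x k, 0 < x -> rising (x + 1) k = rising x k * (x + INR k) / x).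
  { intros x k Hx. rewrite <- rising_shift; field; lra. }
  replace (p + 1 + u) with (p + u + 1) by ring.
  replace (p + 1 + w) with (p + w + 1) by ring.
  replace (p + u + 1 + w) with (p + u + w + 1) by ring.
  rewrite !E by lra.
  rewrite !plus_INR, !mult_INR.
  pose proof (pos_INR j) as Hj.
  pose proof (rising_pos 1 j Rlt_0_1).
  pose proof (rising_pos (p + u) (2 * j + 2) ltac:(lra)).
  pose proof (rising_pos (p + w) (2 * j + 2) ltac:(lra)).
  set (x := INR j) in *. simpl INR.
  field. repeat split; lra.
Qed.

(** Both sides are rational multiples of [weight u w p j], by [weight_S] and
    [weight_shift]; after dividing by it the claim is an identity of rational
    functions. *)
Lemma term_telescopes (u w p : R) (j : nat) :
  0 < u < 1 -> 0 < w < 1 -> 0 < p ->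
  term u w (p + 1) j - rho u w p * term u w p j =
  rho u w p * (cert u w p (S j) - cert u w p j).
Proof.
  intros Hu Hw Hp; unfold term, cert.
  rewrite weight_S, weight_shift, S_INR by assumption.
  pose proof (pos_INR j) as Hj.
  set (x := INR j) in *.
  generalize (weight u w p j), (rho u w p); intros c r.
  unfold cubic. field. repeat split; lra.
Qed.

Lemma weight_0 (u w p : R) : 0 < u < 1 -> 0 < w < 1 -> 0 < p ->
  weight u w p 0 = p / ((p + u) * (p + u + 1) * ((p + w) * (p + w + 1))).
Proof. intros Hu Hw Hp; unfold weight; simpl; field; repeat split; lra. Qed.

Lemma cert_S (u w p : R) (j : nat) :
  0 < u < 1 -> 0 < w < 1 -> 0 < p ->
  cert u w p (S (S j)) =
  - cert u w p (S j)
  * ((p + 2 * INR (S j) + 2) / (p + u + 2 * INR (S j) + 2)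
     * ((p + 2 * INR (S j) + 1) / (p + u + 2 * INR (S j) + 1))
     * ((1 - u + INR (S j)) / INR (S j))
     * ((1 - w + INR (S j)) * (p + u + w + INR (S j))
        / ((p + w + 2 * INR (S j) + 1) * (p + w + 2 * INR (S j) + 2)))).
Proof.
  intros Hu Hw Hp; unfold cert.
  rewrite (weight_S u w p (S j)) by assumption.
  rewrite (S_INR (S j)).
  assert (Hj : 0 < INR (S j)) by (apply lt_0_INR; lia).
  set (x := INR (S j)) in *. generalize (weight u w p (S j)); intros c.
  field. repeat split; lra.
Qed.

(** * Geometric decay of the certificate *)

Lemma Rdiv_bounds (x y k : R) : 0 < y -> 0 <= x -> x <= k * y -> 0 <= x / y <= k.
Proof.
  intros Hy Hx H; split; [apply Rdiv_le_0_compat; lra|].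
  apply Rle_div_l; lra.
Qed.

Lemma Rmult_bounds (x y k l : R) :
  0 <= x <= k -> 0 <= y <= l -> 0 <= x * y <= k * l.
Proof.
  intros; split; [apply Rmult_le_pos; lra | apply Rmult_le_compat; lra].
Qed.

(** In the ratio given by [cert_S] the first two factors are at most 1, the third
    at most 2, and the fourth at most 1/3: with [x] for the index, its numerator is a
    product of two numbers with sum [p + u + 1 + 2 x], hence at most
    [(p + w + 2 x + 2)^2 / 4], because [u - w < 1].  The rate is uniform in [p], which is what permits
    the limit in [p] to be taken on partial sums of fixed length. *)
Lemma cert_contracts (u w p : R) (j : nat) :
  0 < u < 1 -> 0 < w < 1 -> 0 < p ->
  Rabs (cert u w p (S (S j))) <= Rabs (cert u w p (S j)) * (2 / 3).
Proof.
  intros Hu Hw Hp. rewrite cert_S, Rabs_mult, Rabs_Ropp by assumption.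
  apply Rmult_le_compat_l; [apply Rabs_pos|].
  assert (Hx : 1 <= INR (S j)) by (rewrite S_INR; pose proof (pos_INR j); lra).
  set (x := INR (S j)) in *.
  assert (B : 0 <=
     (p + 2 * x + 2) / (p + u + 2 * x + 2)
     * ((p + 2 * x + 1) / (p + u + 2 * x + 1))
     * ((1 - u + x) / x)
     * ((1 - w + x) * (p + u + w + x) / ((p + w + 2 * x + 1) * (p + w + 2 * x + 2)))
     <= 1 * 1 * 2 * (1 / 3)).
  { apply Rmult_bounds; [apply Rmult_bounds; [apply Rmult_bounds|]|];
      apply Rdiv_bounds; try lra; try nra. }
  rewrite Rabs_pos_eq; lra.
Qed.

Lemma cert_geometric (u w p : R) (j : nat) :
  0 < u < 1 -> 0 < w < 1 -> 0 < p ->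
  Rabs (cert u w p (S j)) <= Rabs (cert u w p 1) * (2 / 3) ^ j.
Proof.
  intros Hu Hw Hp; induction j as [|j IH]; [simpl; lra|].
  pose proof (cert_contracts u w p j Hu Hw Hp). simpl pow. lra.
Qed.

(** The sign is what turns the estimate of [transported_partial_sum] into a
    telescoping sum. *)
Lemma cert_1_neg (u w p : R) :
  0 < u < 1 -> 0 < w < 1 -> 0 < p -> cert u w p 1 <= 0.
Proof.
  intros Hu Hw Hp; unfold cert; rewrite weight_S, weight_0 by assumption.
  simpl INR.
  match goal with |- ?x <= 0 => cut (0 <= - x); [lra|] end.
  rewrite Ropp_mult_distr_r.
  apply Rmult_le_pos; [repeat apply Rmult_le_pos; lra|].
  unfold Rdiv at 1. rewrite 2!Ropp_mult_distr_l, Ropp_involutive.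
  apply Rmult_le_pos.
  - apply Rmult_le_pos; [|repeat apply Rmult_le_pos; lra].
    apply Rdiv_le_0_compat; [lra|]. repeat apply Rmult_lt_0_compat; lra.
  - apply Rlt_le, Rinv_0_lt_compat. repeat apply Rmult_lt_0_compat; lra.
Qed.

(** * Moving the parameter to infinity *)

Fixpoint invprod (u w p : R) (n : nat) : R :=
  match n with
  | O => 1
  | S k => invprod u w p k / rho u w (p + INR k)
  end.

Lemma rho_pos (u w p : R) : 0 < u < 1 -> 0 < w < 1 -> 0 < p -> 0 < rho u w p.
Proof.
  intros Hu Hw Hp; unfold rho.
  apply Rdiv_lt_0_compat; apply Rmult_lt_0_compat; lra.
Qed.

Lemma invprod_pos (u w p : R) (n : nat) :
  0 < u < 1 -> 0 < w < 1 -> 0 < p -> 0 < invprod u w p n.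
Proof.
  intros Hu Hw Hp; induction n as [|n IH]; simpl; [lra|].
  apply Rdiv_lt_0_compat; [exact IH|]. apply rho_pos; try assumption.
  pose proof (pos_INR n); lra.
Qed.

Lemma partial_sum_shift (u w p : R) (j : nat) :
  0 < u < 1 -> 0 < w < 1 -> 0 < p ->
  sum_n (term u w (p + 1)) j =
  rho u w p * (sum_n (term u w p) j + cert u w p (S j)).
Proof.
  intros Hu Hw Hp; induction j as [|j IH].
  - rewrite !sum_O. pose proof (term_telescopes u w p 0 Hu Hw Hp) as H.
    assert (cert u w p 0 = 0) by (unfold cert; simpl; ring).
    nra.
  - rewrite !sum_Sn. unfold plus; simpl.
    pose proof (term_telescopes u w p (S j) Hu Hw Hp) as H.
    rewrite IH. lra.
Qed.

Lemma invprod_step (u w p : R) (n j : nat) :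
  0 < u < 1 -> 0 < w < 1 -> 0 < p ->
  invprod u w p (S n) * sum_n (term u w (p + INR (S n))) j =
  invprod u w p n * (sum_n (term u w (p + INR n)) j + cert u w (p + INR n) (S j)).
Proof.
  intros Hu Hw Hp.
  assert (Hq : 0 < p + INR n) by (pose proof (pos_INR n); lra).
  rewrite S_INR, <- Rplus_assoc, partial_sum_shift by assumption.
  pose proof (rho_pos u w _ Hu Hw Hq). simpl invprod. field. lra.
Qed.

(** Moving from [p] to [p + n] changes the normalised partial sum of length
    [j + 1] by a weighted sum of values of [cert] at [j + 1].  Each of them is at
    most [(2/3)^j] times the value at 1 in absolute value; as the values at 1 all
    have the same sign and are themselves the changes for [j = 0], their weighted
    sum telescopes to a difference of initial terms. *)
Lemma transported_partial_sum (u w p : R) (n j : nat) :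
  0 < u < 1 -> 0 < w < 1 -> 0 < p ->
  Rabs (invprod u w p n * sum_n (term u w (p + INR n)) j - sum_n (term u w p) j)
  <= (term u w p 0 - invprod u w p n * term u w (p + INR n) 0) * (2 / 3) ^ j.
Proof.
  intros Hu Hw Hp; induction n as [|n IH].
  - simpl. rewrite Rplus_0_r, !Rmult_1_l, !Rminus_diag, Rabs_R0; lra.
  - assert (Hq : 0 < p + INR n) by (pose proof (pos_INR n); lra).
    pose proof (invprod_step u w p n 0 Hu Hw Hp) as E.
    rewrite !sum_O in E. rewrite E, invprod_step by assumption.
    pose proof (invprod_pos u w p n Hu Hw Hp) as HW.
    pose proof (cert_geometric u w _ j Hu Hw Hq) as HG.
    pose proof (cert_1_neg u w _ Hu Hw Hq) as H1.
    rewrite (Rabs_left1 _ H1) in HG.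
    set (W := invprod u w p n) in *.
    set (c := cert u w (p + INR n) (S j)) in *.
    set (A := sum_n (term u w (p + INR n)) j) in *.
    set (B := sum_n (term u w p) j) in *.
    replace (W * (A + c) - B) with ((W * A - B) + W * c) by ring.
    eapply Rle_trans; [apply Rabs_triang|].
    rewrite Rabs_mult, (Rabs_pos_eq W) by lra.
    apply (Rmult_le_compat_l W) in HG; [|lra]. lra.
Qed.

(** The five factors of the ratio are paired with denominators so that only the
    last one depends on [p] in the bound. *)
Lemma weight_ratio_bound (u w p : R) (j : nat) :
  0 < u < 1 -> 0 < w < 1 -> 1 <= p ->
  Rabs (weight u w p (S j)) <= Rabs (weight u w p j) * ((INR j + 1) / p).
Proof.
  intros Hu Hw Hp.
  rewrite weight_S by lra. pose proof (pos_INR j) as Hx. set (x := INR j) in *.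
  unfold Rdiv at 1.
  rewrite !Rmult_assoc, Rabs_mult, Rabs_Ropp.
  apply Rmult_le_compat_l; [apply Rabs_pos|].
  match goal with |- Rabs ?t <= _ =>
   replace t with ((p + 2 * x + 1) / (p + u + 2 * x + 2)
     * ((p + 2 * x + 2) / (p + u + 2 * x + 3))
     * ((1 - u + x) / (x + 1))
     * ((p + u + w + x) / (p + w + 2 * x + 2))
     * ((1 - w + x) / (p + w + 2 * x + 3))) by (field; repeat split; lra) end.
  match goal with |- Rabs ?t <= _ =>
    assert (B : 0 <= t <= 1 * 1 * 1 * 1 * ((x + 1) / p)) end.
  { apply Rmult_bounds; [apply Rmult_bounds; [apply Rmult_bounds; [apply Rmult_bounds|]|]|];
      apply Rdiv_bounds; try lra.
    unfold Rdiv; rewrite Rmult_assoc. apply Rle_trans with ((x + 1) * 1); [lra|].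
    apply Rmult_le_compat_l; [lra|].
    rewrite Rmult_comm. apply Rle_div_r; lra. }
  rewrite Rabs_pos_eq; lra.
Qed.

Lemma weight_0_bound (u w p : R) : 0 < u < 1 -> 0 < w < 1 -> 1 <= p ->
  Rabs (weight u w p 0) <= 1 / p ^ 3.
Proof.
  intros Hu Hw Hp; rewrite weight_0 by lra.
  replace (p / _) with (p / (p + u) * (1 / ((p + u + 1) * ((p + w) * (p + w + 1)))))
    by (field; repeat split; lra).
  assert (0 < p ^ 3) by (apply pow_lt; lra).
  assert (B : 0 <= p / (p + u) * (1 / ((p + u + 1) * ((p + w) * (p + w + 1))))
             <= 1 * (1 / p ^ 3)).
  { apply Rmult_bounds; [apply Rdiv_bounds; lra|].
    assert (p ^ 3 <= (p + u + 1) * ((p + w) * (p + w + 1))).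
    { replace (p ^ 3) with (p * (p * p)) by ring.
      repeat (apply Rmult_le_compat; try nra). }
    split.
    - apply Rdiv_le_0_compat; lra.
    - unfold Rdiv; apply Rmult_le_compat_l; [lra|]. apply Rinv_le_contravar; lra. }
  rewrite Rabs_pos_eq; lra.
Qed.

(** One factor [1/p] is gained from the first step; later steps only need the
    ratio to be bounded. *)
Lemma weight_bound (u w : R) (j : nat) : 0 < u < 1 -> 0 < w < 1 ->
  exists K, forall p, 1 <= p -> Rabs (weight u w p (S j)) <= K / p ^ 4.
Proof.
  intros Hu Hw; induction j as [|j [K HK]].
  - exists 1; intros p Hp.
    pose proof (weight_ratio_bound u w p 0 Hu Hw Hp) as H1.
    pose proof (weight_0_bound u w p Hu Hw Hp) as H0.
    eapply Rle_trans; [exact H1|].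
    replace (1 / p ^ 4) with (1 / p ^ 3 * ((INR 0 + 1) / p)) by (simpl; field; lra).
    apply Rmult_le_compat_r; [|exact H0]. simpl; apply Rdiv_le_0_compat; lra.
  - exists (K * (INR (S j) + 1)); intros p Hp.
    pose proof (weight_ratio_bound u w p (S j) Hu Hw Hp) as H1.
    specialize (HK p Hp). pose proof (pos_INR (S j)) as Hx.
    set (x := INR (S j)) in *.
    eapply Rle_trans; [exact H1|].
    apply Rle_trans with (Rabs (weight u w p (S j)) * (x + 1)).
    + apply Rmult_le_compat_l; [apply Rabs_pos|].
      apply Rle_div_l; nra.
    + replace (K * (x + 1) / p ^ 4) with (K / p ^ 4 * (x + 1)) by (unfold Rdiv; ring).
      apply Rmult_le_compat_r; lra.
Qed.

Lemma cubic_bound (u w p x : R) : 0 < u < 1 -> 0 < w < 1 -> 1 <= p -> 0 <= x ->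
  0 <= cubic u w p x <= (10 * x ^ 3 + 42 * x ^ 2 + 51 * x + 18) * p ^ 3.
Proof.
  intros Hu Hw Hp Hx.
  assert (H2 : p <= p ^ 2) by nra.
  assert (H3 : p ^ 2 <= p ^ 3) by nra.
  assert (0 < u * w < 1) by nra.
  assert (0 <= p * (u + w) <= p * 2) by nra.
  assert (C0 : 0 <= (p + 1) * (p + 2) * (p + u + w) <= 18 * p ^ 3).
  { replace (18 * p ^ 3) with (2 * p * (3 * p) * (3 * p)) by ring.
    apply Rmult_bounds; [apply Rmult_bounds|]; lra. }
  assert (Hx2 : 0 <= x ^ 2) by (apply pow_le; lra).
  assert (Hx3 : 0 <= x ^ 3) by (apply pow_le; lra).
  assert (C1 : 0 <= (7 * p ^ 2 + 6 * p * (u + w) + 12 * p + u * w + 8 * (u + w) + 3) * x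
               <= 51 * p ^ 3 * x).
  { apply Rmult_bounds; lra. }
  assert (C2 : 0 <= (15 * p + 8 * (u + w) + 11) * x ^ 2 <= 42 * p ^ 3 * x ^ 2).
  { apply Rmult_bounds; lra. }
  assert (C3 : 0 <= 10 * x ^ 3 <= 10 * p ^ 3 * x ^ 3).
  { apply Rmult_bounds; lra. }
  unfold cubic; lra.
Qed.

Lemma term_bound (u w : R) (j : nat) : 0 < u < 1 -> 0 < w < 1 ->
  exists K, forall p, 1 <= p -> Rabs (term u w p (S j)) <= K / p.
Proof.
  intros Hu Hw; destruct (weight_bound u w j Hu Hw) as [K HK].
  set (x := INR (S j)).
  exists (K * (10 * x ^ 3 + 42 * x ^ 2 + 51 * x + 18)); intros p Hp.
  unfold term; fold x; rewrite Rabs_mult.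
  pose proof (cubic_bound u w p x Hu Hw Hp (pos_INR _)) as B.
  rewrite (Rabs_pos_eq (cubic _ _ _ _)) by lra.
  replace (K * (10 * x ^ 3 + 42 * x ^ 2 + 51 * x + 18) / p)
    with (K / p ^ 4 * ((10 * x ^ 3 + 42 * x ^ 2 + 51 * x + 18) * p ^ 3))
    by (field; lra).
  apply Rmult_le_compat; [apply Rabs_pos | lra | auto | lra].
Qed.

(** The initial term is [(1 - x) (1 + y)] with [x] and [y] both at most [1/p] in
    absolute value. *)
Lemma term_0_bound (u w p : R) : 0 < u < 1 -> 0 < w < 1 -> 1 <= p ->
  Rabs (term u w p 0 - 1) <= 3 / p.
Proof.
  intros Hu Hw Hp. unfold term; rewrite weight_0 by lra; unfold cubic; simpl INR.
  set (x := u * w / ((p + u) * (p + w))).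
  set (y := ((p + 1) * (1 - u - w) - u * w) / ((p + u + 1) * (p + w + 1))).
  match goal with |- Rabs ?t <= _ => replace t with (y - x - x * y)
    by (unfold x, y; field; repeat split; lra) end.
  assert (Huw : 0 < u * w < 1) by nra.
  assert (Hp1 : 0 < 1 / p <= 1).
  { split; [apply Rdiv_lt_0_compat; lra | apply Rle_div_l; lra]. }
  assert (HX : 0 <= x <= 1 / p).
  { apply Rdiv_bounds; [apply Rmult_lt_0_compat; lra | lra |].
    replace (1 / p * ((p + u) * (p + w))) with (p + u + w + u * w * (1 / p))
      by (field; lra).
    assert (0 <= u * w * (1 / p)) by (apply Rmult_le_pos; lra).
    lra. }
  assert (HD : (p + 1) ^ 2 <= (p + u + 1) * (p + w + 1)).
  { simpl; rewrite Rmult_1_r; apply Rmult_le_compat; lra. }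
  assert (HE : p + 2 <= 1 / p * (p + 1) ^ 2).
  { replace (1 / p * (p + 1) ^ 2) with (p + 2 + 1 / p) by (field; lra). lra. }
  assert (HF : p + 2 <= 1 / p * ((p + u + 1) * (p + w + 1))).
  { eapply Rle_trans; [exact HE | apply Rmult_le_compat_l; lra]. }
  assert (HN : - (p + 2) <= (p + 1) * (1 - u - w) - u * w <= p + 2) by nra.
  assert (HY : Rabs y <= 1 / p).
  { unfold y; apply Rabs_le; split; [apply Rle_div_r | apply Rle_div_l]; nra. }
  apply Rabs_le_between in HY; apply Rabs_le.
  assert (- x <= x * y <= x) by nra.
  replace (3 / p) with (1 / p + 1 / p + 1 / p) by (field; lra).
  lra.
Qed.

Lemma partial_sum_bound (u w : R) (j : nat) : 0 < u < 1 -> 0 < w < 1 ->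
  exists K, forall p, 1 <= p -> Rabs (sum_n (term u w p) j - 1) <= K / p.
Proof.
  intros Hu Hw; induction j as [|j [K HK]].
  - exists 3; intros p Hp; rewrite sum_O; apply term_0_bound; assumption.
  - destruct (term_bound u w j Hu Hw) as [L HL].
    exists (K + L); intros p Hp; rewrite sum_Sn; unfold plus; simpl.
    specialize (HK p Hp); specialize (HL p Hp).
    replace (sum_n (term u w p) j + term u w p (S j) - 1)
      with ((sum_n (term u w p) j - 1) + term u w p (S j)) by ring.
    eapply Rle_trans; [apply Rabs_triang|].
    rewrite Rdiv_plus_distr. lra.
Qed.

Lemma is_lim_seq_dominated (a b : nat -> R) (l : R) :
  (forall n, Rabs (a n - l) <= b n) -> is_lim_seq b 0 -> is_lim_seq a l.
Proof.
  intros H Hb.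
  apply (is_lim_seq_le_le (fun n => l - b n) _ (fun n => l + b n)).
  - intros n; specialize (H n); apply Rabs_le_between in H; lra.
  - replace (Finite l) with (Finite (l - 0)) by (f_equal; ring).
    apply is_lim_seq_minus'; [apply is_lim_seq_const | exact Hb].
  - replace (Finite l) with (Finite (l + 0)) by (f_equal; ring).
    apply is_lim_seq_plus'; [apply is_lim_seq_const | exact Hb].
Qed.

Lemma is_lim_seq_inv_S (K : R) : is_lim_seq (fun n => K / INR (S n)) 0.
Proof.
  replace (Finite 0) with (Rbar_mult K 0) by (simpl; f_equal; ring).
  apply is_lim_seq_scal_l.
  apply (is_lim_seq_incr_1 (fun n => / INR n)).
  replace (Finite 0) with (Rbar_inv p_infty) by reflexivity.
  apply is_lim_seq_inv; [apply is_lim_seq_INR | discriminate].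
Qed.

Lemma partial_sum_lim (u w p : R) (j : nat) :
  0 < u < 1 -> 0 < w < 1 -> 0 < p ->
  is_lim_seq (fun n => sum_n (term u w (p + INR n)) j) 1.
Proof.
  intros Hu Hw Hp; destruct (partial_sum_bound u w j Hu Hw) as [K HK].
  assert (K0 : 0 <= K).
  { specialize (HK 1 (Rle_refl 1)). rewrite Rdiv_1_r in HK.
    eapply Rle_trans; [apply Rabs_pos | exact HK]. }
  apply is_lim_seq_incr_1.
  apply (is_lim_seq_dominated _ _ _) with (2 := is_lim_seq_inv_S K); intros n.
  assert (1 <= INR (S n)) by (rewrite S_INR; pose proof (pos_INR n); lra).
  eapply Rle_trans; [apply HK; lra|].
  apply Rmult_le_compat_l; [exact K0|]. apply Rinv_le_contravar; lra.
Qed.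

Lemma term_0_pos (u w p : R) : 0 < u < 1 -> 0 < w < 1 -> 0 < p ->
  0 < term u w p 0.
Proof.
  intros Hu Hw Hp; unfold term; rewrite weight_0 by assumption.
  unfold cubic; simpl INR.
  apply Rmult_lt_0_compat.
  - apply Rdiv_lt_0_compat; [lra|]. repeat apply Rmult_lt_0_compat; lra.
  - assert (0 < (p + 1) * (p + 2) * (p + u + w))
      by (repeat apply Rmult_lt_0_compat; lra).
    lra.
Qed.

(** In [transported_partial_sum] let the shift tend to infinity with the length
    fixed: the transported partial sum tends to [l], and the error bound
    [(2/3)^j] times the initial term survives.  Convergence of the series
    comes out together with its value. *)
Lemma series_of_product (u w p l : R) :
  0 < u < 1 -> 0 < w < 1 -> 0 < p ->
  is_lim_seq (invprod u w p) l -> is_series (term u w p) l.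
Proof.
  intros Hu Hw Hp Hl.
  change (is_lim_seq (sum_n (term u w p)) l).
  apply is_lim_seq_dominated with (fun j => term u w p 0 * (2 / 3) ^ j).
  - intros j.
    assert (HA : is_lim_seq (fun n =>
        Rabs (invprod u w p n * sum_n (term u w (p + INR n)) j
              - sum_n (term u w p) j))
      (Rabs (l * 1 - sum_n (term u w p) j))).
    { apply (is_lim_seq_abs _ (Finite _)). apply is_lim_seq_minus'.
      - apply is_lim_seq_mult'; [exact Hl | apply partial_sum_lim; assumption].
      - apply is_lim_seq_const. }
    rewrite Rabs_minus_sym. rewrite Rmult_1_r in HA.
    refine (is_lim_seq_le _ _ (Finite _) (Finite _) _ HA (is_lim_seq_const _)).
    intros n; eapply Rle_trans; [apply transported_partial_sum; assumption|].
    apply Rmult_le_compat_r; [apply pow_le; lra|].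
    assert (0 < invprod u w p n * term u w (p + INR n) 0).
    { apply Rmult_lt_0_compat; [apply invprod_pos; assumption|].
      apply term_0_pos; try assumption. pose proof (pos_INR n); lra. }
    lra.
  - replace (Finite 0) with (Rbar_mult (term u w p 0) 0) by (simpl; f_equal; ring).
    apply is_lim_seq_scal_l, is_lim_seq_geom. rewrite Rabs_pos_eq; lra.
Qed.

(** * The infinite product *)

Definition cos_moment (n : nat) (y : R) : R :=
  RInt (fun t => cos t ^ n * cos (y * t)) 0 (PI / 2).

Lemma continuous_cos_moment (n : nat) (y t : R) :
  continuous (fun t => cos t ^ n * cos (y * t)) t.
Proof.
  apply (ex_derive_continuous (fun t => cos t ^ n * cos (y * t))).
  auto_derive; exact I.
Qed.

Lemma ex_cos_moment (n : nat) (y : R) :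
  ex_RInt (fun t => cos t ^ n * cos (y * t)) 0 (PI / 2).
Proof. apply (ex_RInt_continuous (V := R_CompleteNormedModule)); intros; apply continuous_cos_moment. Qed.

(** Integrate the derivative of
    [(n+2) cos^(n+1) t sin t cos (y t) - y cos^(n+2) t sin (y t)], which vanishes
    at both ends of the interval. *)
Lemma cos_moment_rec (n : nat) (y : R) :
  (INR (n + 2) ^ 2 - y ^ 2) * cos_moment (n + 2) y
  = INR (n + 2) * INR (n + 1) * cos_moment n y.
Proof.
  set (H := fun t => INR (n + 2) * cos t ^ (n + 1) * sin t * cos (y * t)
                     - y * cos t ^ (n + 2) * sin (y * t)).
  set (h := fun t => (INR (n + 2) ^ 2 - y ^ 2) * (cos t ^ (n + 2) * cos (y * t))
                     - INR (n + 2) * INR (n + 1) * (cos t ^ n * cos (y * t))).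
  assert (E : is_RInt h 0 (PI / 2) (minus (H (PI / 2)) (H 0))).
  { apply (is_RInt_derive H h).
    - intros t _; unfold H, h; auto_derive; [exact I|].
      replace (Init.Nat.pred (n + 1)) with n by lia.
      replace (Init.Nat.pred (n + 2)) with (n + 1)%nat by lia.
      rewrite !pow_add, !plus_INR; simpl.
      assert (S : sin t ^ 2 = 1 - cos t ^ 2)
        by (pose proof (sin2_cos2 t) as S; unfold Rsqr in S; lra).
      ring [S].
    - intros t _; unfold h.
      apply (continuous_minus (V := R_NormedModule));
        apply (continuous_scal_r (V := R_NormedModule)); apply continuous_cos_moment. }
  assert (F : is_RInt h 0 (PI / 2)
     ((INR (n + 2) ^ 2 - y ^ 2) * cos_moment (n + 2) y
      - INR (n + 2) * INR (n + 1) * cos_moment n y)).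
  { apply (is_RInt_minus (V := R_NormedModule));
      apply (is_RInt_scal (V := R_NormedModule));
      apply (RInt_correct (V := R_CompleteNormedModule)), ex_cos_moment. }
  pose proof (is_RInt_unique _ _ _ _ E) as E1.
  rewrite (is_RInt_unique _ _ _ _ F) in E1.
  unfold H, minus, plus, opp in E1; simpl in E1.
  rewrite !plus_INR, !pow_add in E1; simpl in E1.
  rewrite sin_0, cos_PI2, !Rmult_0_r, sin_0 in E1.
  rewrite plus_INR, plus_INR; simpl. lra.
Qed.

(** On the interval of integration [cos^2 t <= cos t <= cos (y t) <= 1].  Since
    [cos_moment (n + 2) 0] is asymptotic to [cos_moment n 0], this makes all
    the moments with [0 <= y <= 1] asymptotically equal. *)
Lemma cos_moment_bounds (n : nat) (y : R) : 0 <= y <= 1 ->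
  cos_moment (n + 2) 0 <= cos_moment n y <= cos_moment n 0.
Proof.
  intros Hy; pose proof PI_RGT_0 as HPI.
  split; (apply RInt_le; [lra | apply ex_cos_moment | apply ex_cos_moment |]);
    intros t Ht; rewrite Rmult_0_l, cos_0, Rmult_1_r.
  - assert (Hc : 0 <= cos t) by (apply cos_ge_0; lra).
    assert (Hyt : cos t <= cos (y * t)) by (apply cos_decr_1; nra).
    pose proof (COS_bound t).
    rewrite pow_add; apply Rmult_le_compat_l; [apply pow_le; exact Hc | nra].
  - assert (Hc : 0 <= cos t) by (apply cos_ge_0; lra).
    pose proof (COS_bound (y * t)).
    pose proof (pow_le _ n Hc). nra.
Qed.

Lemma cos_moment_0 (y : R) : y <> 0 -> cos_moment 0 y = sin (y * (PI / 2)) / y.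
Proof.
  intros Hy; unfold cos_moment; apply is_RInt_unique.
  replace (sin (y * (PI / 2)) / y)
    with (minus (sin (y * (PI / 2)) / y) (sin (y * 0) / y))
    by (unfold minus, plus, opp; simpl; rewrite Rmult_0_r, sin_0; field; exact Hy).
  apply (is_RInt_derive (fun t => sin (y * t) / y)).
  - intros t _; auto_derive; [exact I | simpl; field; exact Hy].
  - intros t _; apply continuous_cos_moment.
Qed.

Lemma cos_moment_even_pos (n : nat) : 0 < cos_moment (2 * n) 0.
Proof.
  induction n as [|n IH].
  - unfold cos_moment; rewrite (RInt_ext _ (fun _ => 1)).
    + rewrite RInt_const; unfold scal; simpl; unfold mult; simpl.
      pose proof PI_RGT_0; lra.
    + intros t _; simpl; rewrite Rmult_0_l, cos_0; ring.
  - pose proof (cos_moment_rec (2 * n) 0) as E.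
    replace (2 * S n)%nat with (2 * n + 2)%nat by lia.
    assert (H1 : 0 < INR (2 * n + 1)) by (apply lt_0_INR; lia).
    assert (H2 : 0 < INR (2 * n + 2)) by (apply lt_0_INR; lia).
    apply Rmult_lt_reg_l with (INR (2 * n + 2) ^ 2 - 0 ^ 2); [nra|].
    rewrite E, Rmult_0_r. repeat apply Rmult_lt_0_compat; assumption.
Qed.

(** The factor [1 / rho] at [3/4 + n] is
    [((n+1)^2 - 1/16) / ((n+1)^2 - 1/36)], which is also the factor by which
    [cos_moment_rec] changes the quotient of the moments at [y = 1/3] and
    [y = 1/2]. *)
Lemma invprod_cos_moment (n : nat) :
  invprod (5 / 12) (1 / 12) (3 / 4) n * (cos_moment (2 * n) (1 / 2) * cos_moment 0 (1 / 3))
  = cos_moment (2 * n) (1 / 3) * cos_moment 0 (1 / 2).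
Proof.
  induction n as [|n IH]; [simpl; ring|].
  replace (2 * S n)%nat with (2 * n + 2)%nat by lia.
  pose proof (cos_moment_rec (2 * n) (1 / 2)) as E2.
  pose proof (cos_moment_rec (2 * n) (1 / 3)) as E3.
  simpl invprod. unfold rho.
  rewrite !plus_INR, !mult_INR in E2, E3; simpl INR in E2, E3.
  pose proof (pos_INR n) as Hx; set (x := INR n) in *.
  set (a2 := cos_moment (2 * n) (1 / 2)) in *.
  set (a3 := cos_moment (2 * n) (1 / 3)) in *.
  assert (D2 : 0 < (2 * x + 2) ^ 2 - 1 / 4) by nra.
  assert (D3 : 0 < (2 * x + 2) ^ 2 - 1 / 9) by nra.
  assert (F2 : cos_moment (2 * n + 2) (1 / 2)
     = (2 * x + 2) * (2 * x + 1) * a2 / ((2 * x + 2) ^ 2 - 1 / 4)).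
  { replace ((2 * x + 2) * (2 * x + 1) * a2)
      with (((2 * x + 2) ^ 2 - 1 / 4) * cos_moment (2 * n + 2) (1 / 2)) by lra.
    field. lra. }
  assert (F3 : cos_moment (2 * n + 2) (1 / 3)
     = (2 * x + 2) * (2 * x + 1) * a3 / ((2 * x + 2) ^ 2 - 1 / 9)).
  { replace ((2 * x + 2) * (2 * x + 1) * a3)
      with (((2 * x + 2) ^ 2 - 1 / 9) * cos_moment (2 * n + 2) (1 / 3)) by lra.
    field. lra. }
  rewrite F2, F3.
  transitivity (invprod (5 / 12) (1 / 12) (3 / 4) n * (a2 * cos_moment 0 (1 / 3))
     * ((2 * x + 2) * (2 * x + 1) / ((2 * x + 2) ^ 2 - 1 / 9))).
  - field. repeat split; nra.
  - rewrite IH. field. nra.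
Qed.

(** The quotient of the moments at [1/3] and [1/2] tends to 1, so the product is
    the quotient of the moments of order 0, [sqrt 2] and [3/2]. *)
Lemma invprod_lim :
  is_lim_seq (invprod (5 / 12) (1 / 12) (3 / 4)) (2 * sqrt 2 / 3).
Proof.
  assert (V2 : cos_moment 0 (1 / 2) = sqrt 2).
  { rewrite cos_moment_0 by lra.
    replace (1 / 2 * (PI / 2)) with (PI / 4) by field.
    rewrite sin_PI4. pose proof (sqrt_lt_R0 2 ltac:(lra)).
    apply Rmult_eq_reg_r with (sqrt 2); [|lra].
    rewrite sqrt_sqrt by lra. field. lra. }
  assert (V3 : cos_moment 0 (1 / 3) = 3 / 2).
  { rewrite cos_moment_0 by lra.
    replace (1 / 3 * (PI / 2)) with (PI / 6) by field.
    rewrite sin_PI6. field. }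
  assert (B : forall n, 0 < cos_moment (2 * n) (1 / 2) /\
     Rabs (cos_moment (2 * n) (1 / 3) / cos_moment (2 * n) (1 / 2) - 1) <= 1 / INR (S n)).
  { intros n.
    pose proof (cos_moment_even_pos n) as P0.
    pose proof (cos_moment_rec (2 * n) 0) as E.
    pose proof (cos_moment_bounds (2 * n) (1 / 2) ltac:(lra)) as [L2 U2].
    pose proof (cos_moment_bounds (2 * n) (1 / 3) ltac:(lra)) as [L3 U3].
    rewrite S_INR. rewrite !plus_INR, !mult_INR in E; simpl INR in E.
    pose proof (pos_INR n) as Hx; set (x := INR n) in *.
    set (m := cos_moment (2 * n) 0) in *.
    set (m' := cos_moment (2 * n + 2) 0) in *.
    set (a2 := cos_moment (2 * n) (1 / 2)) in *.
    set (a3 := cos_moment (2 * n) (1 / 3)) in *.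
    assert (E' : (2 * x + 2) * m' = (2 * x + 1) * m).
    { apply Rmult_eq_reg_l with (2 * x + 2); lra. }
    assert (Hm : m <= 2 * m') by nra.
    assert (H2 : 0 < a2) by lra.
    split; [exact H2|].
    replace (a3 / a2 - 1) with ((a3 - a2) / a2) by (field; lra).
    assert (K : (m - m') * (x + 1) <= a2) by lra.
    assert (K1 : (a3 - a2) * (x + 1) <= a2).
    { eapply Rle_trans; [|exact K]. apply Rmult_le_compat_r; lra. }
    assert (K2 : (a2 - a3) * (x + 1) <= a2).
    { eapply Rle_trans; [|exact K]. apply Rmult_le_compat_r; lra. }
    apply Rabs_le; split.
    - apply Rle_div_r; [exact H2|].
      replace (- (1 / (x + 1)) * a2) with (- (a2 / (x + 1))) by (field; lra).
      apply Rle_div_r in K2; lra.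
    - apply Rle_div_l; [exact H2|].
      replace (1 / (x + 1) * a2) with (a2 / (x + 1)) by (field; lra).
      apply Rle_div_r; lra. }
  apply is_lim_seq_ext with (fun n =>
    cos_moment (2 * n) (1 / 3) / cos_moment (2 * n) (1 / 2) * (2 * sqrt 2 / 3)).
  - intros n; pose proof (invprod_cos_moment n) as H.
    rewrite V2, V3 in H. destruct (B n) as [H2 _].
    apply Rmult_eq_reg_r with (cos_moment (2 * n) (1 / 2) * (3 / 2)); [|lra].
    rewrite H. field. lra.
  - replace (Finite (2 * sqrt 2 / 3)) with (Rbar_mult 1 (2 * sqrt 2 / 3))
      by (simpl; f_equal; ring).
    apply is_lim_seq_scal_r.
    apply is_lim_seq_dominated with (fun n => 1 / INR (S n)).
    + intros n; apply B.
    + apply is_lim_seq_inv_S.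
Qed.

(** * The given series *)

(** For these parameters [cubic] is
    [10 (j + 9/8) (j + 7/12) (j + 11/12)].  The factor [j + 9/8] accounts for
    [8 j + 9]; the other two, multiplied with [weight], give the quotient of rising
    factorials, as both sides agree at 0 and have the same consecutive ratios. *)
Lemma summand_eq (j : nat) :
  (- (1 / 4)) ^ j
  * ((rising (7 / 8) j * rising (5 / 4) j * rising (11 / 8) j)
     / (rising 1 j * rising (17 / 12) j * rising (25 / 12) j))
  * (8 * INR j + 9)
  = 208 / 27 * term (5 / 12) (1 / 12) (3 / 4) j.
Proof.
  assert (E : (- (1 / 4)) ^ j
    * ((rising (7 / 8) j * rising (5 / 4) j * rising (11 / 8) j)
      / (rising 1 j * rising (17 / 12) j * rising (25 / 12) j))
    = 260 / 27 * weight (5 / 12) (1 / 12) (3 / 4) j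
      * ((INR j + 7 / 12) * (INR j + 11 / 12))).
  { induction j as [|j IH].
    - rewrite weight_0 by lra. simpl. field.
    - rewrite weight_S by lra. rewrite S_INR.
      simpl rising. simpl pow.
      assert (Hj := pos_INR j).
      pose proof (rising_pos 1 j ltac:(lra)).
      pose proof (rising_pos (17 / 12) j ltac:(lra)).
      pose proof (rising_pos (25 / 12) j ltac:(lra)).
      set (x := INR j) in *.
      match type of IH with ?l = _ => transitivity (l *
       (- (1 / 4) * (7 / 8 + x) * (5 / 4 + x) * (11 / 8 + x)
        / ((1 + x) * (17 / 12 + x) * (25 / 12 + x)))) end.
      + field. repeat split; lra.
      + rewrite IH. field. repeat split; lra. }
  rewrite E; unfold term, cubic. field.
Qed.

Theorem mainTheorem10 :
  is_series
    (fun j : nat =>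
       (- (1 / 4)) ^ j
       * ((rising (7 / 8) j * rising (5 / 4) j * rising (11 / 8) j)
          / (rising 1 j * rising (17 / 12) j * rising (25 / 12) j))
       * (8 * INR j + 9))
    (416 * sqrt 2 / 81).
Proof.
  apply (is_series_ext (fun j => 208 / 27 * term (5 / 12) (1 / 12) (3 / 4) j)).
  - intros j; symmetry; apply summand_eq.
  - replace (416 * sqrt 2 / 81) with (208 / 27 * (2 * sqrt 2 / 3)) by field.
    apply (is_series_scal_l (K := R_AbsRing) (V := R_NormedModule)).
    apply series_of_product; try lra. apply invprod_lim.
Qed.
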